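(* Let $K$ be a compact Hausdorff space and let $\alpha$ be an infinite cardinal. The following are equivalent: (1) For some $\lambda>1$, the closed unit ball $B_{C(K)}$ of $C(K)$ contains a $\lambda$-equilateral set of cardinality $\alpha$. (2) The unit sphere $S_{C(K)}$ of $C(K)$ contains a $2$-equilateral set of cardinality $\alpha$ (respectively: the positive part $S^{+}_{C(K)}$ of the unit sphere contains a $1$-equilateral set of cardinality $\alpha$; each of the two versions is equivalent to the other conditions). (3) For some $\varepsilon>0$, the closed unit ball $B_{C(K)}$ contains a $(1+\varepsilon)$-separated set of cardinality $\alpha$. (4) There exists a linked family of closed (nonempty) pairs in $K$ of cardinality $\alpha$ (each of the two versions, linked family of closed pairs and linked family of nonempty closed pairs, is equivalent to the other conditions).
   Context: $C(K)$ is the Banach space of continuous real functions on $K$ with the supremum norm $\|\cdot\|_\infty$; $S_{C(K)}=\{f:\|f\|_\infty=1\}$ and $S^{+}_{C(K)}=\{f\in S_{C(K)}: f\ge 0\}$. A subset $S$ of a metric space $(M,d)$ is $\lambda$-equilateral ($\lambda>0$) if $d(x,y)=\lambda$ for all distinct $x,y\in S$. A set $D$ is $\delta$-separated if $d(x,y)\ge\delta$ for all distinct $x,y\in D$. A family $\{(A_i,B_i): i\in I\}$ of pairs of subsets of a nonempty set $\Gamma$ is called linked if (i) $A_i\cap B_i=\emptyset$ for all $i\in I$; (ii) $A_i\cup B_i\neq\emptyset$ for all $i\in I$; (iii) for all $i\neq j$ in $I$, either $A_i\cap B_j\neq\emptyset$ or $A_j\cap B_i\neq\emptyset$. It is a linked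 family of nonempty pairs if moreover $A_i\neq\emptyset\neq B_i$ for all $i$. A linked family of closed pairs in a topological space is a linked family with all $A_i,B_i$ closed. The cardinality of the family is $|I|$ (distinct indices give distinct pairs by (i) and (iii)). *)

(* Defs.v *)
From HB Require Import structures.
From mathcomp Require Import all_boot all_order all_algebra.
From mathcomp Require Import all_classical all_reals topology normedtype.

Set Implicit Arguments.
Unset Strict Implicit.
Unset Printing Implicit Defensive.

Import Order.TTheory GRing.Theory Num.Theory.
Import numFieldNormedType.Exports.

Local Open Scope classical_set_scope.
Local Open Scope ring_scope.

Section Metric.
Context {R : realType} {M : Type}.
Variable d : M -> M -> R.

Definition equilateral (lambda : R) (S : set M) : Prop :=
  0 < lambda /\ (forall x y, S x -> S y -> x <> y -> d x y = lambda).

Definition separated_by (delta : R) (D : set M) : Prop :=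
  forall x y, D x -> D y -> x <> y -> delta <= d x y.

End Metric.

Section SpaceOfContinuousFunctions.
Context {R : realType} {K : topologicalType}.

(* This is the usual supremum norm when [K] is compact and [f] continuous, so
   that the supremum is over a bounded set; it is 0 when [K] is empty, since
   [sup set0 = 0], as it should be in the trivial space C(K) = {0}. *)
Definition sup_norm (f : K -> R) : R := sup [set `|f x| | x in [set: K]].

Definition sup_dist (f g : continuousType K R) : R := sup_norm (f \- g).

Definition CK_unit_ball : set (continuousType K R) :=
  [set f | sup_norm f <= 1].

Definition CK_unit_sphere : set (continuousType K R) :=
  [set f | sup_norm f = 1].

Definition CK_pos_unit_sphere : set (continuousType K R) :=
  [set f | sup_norm f = 1 /\ forall x, 0 <= f x].

End SpaceOfContinuousFunctions.

Section LinkedFamilies.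
Context {I : Type}.

Definition linked {T : Type} (A B : I -> set T) : Prop :=
  [/\ forall i, A i `&` B i = set0,
      forall i, A i `|` B i !=set0 &
      forall i j, i <> j -> A i `&` B j !=set0 \/ A j `&` B i !=set0].

Definition linked_closed {T : topologicalType} (A B : I -> set T) : Prop :=
  linked A B /\ forall i, closed (A i) /\ closed (B i).

Definition nonempty_pairs {T : Type} (A B : I -> set T) : Prop :=
  forall i, A i !=set0 /\ B i !=set0.

End LinkedFamilies.

(* Main.v *)
(** If [f] and [g] take values in [[c - r, c + r]] and lie at distance more
    than [r], then at some point one is well above [c] and the other well
    below it; hence the superlevel and sublevel sets at heights [c + t] and
    [c - t] form a linked family.  Conversely, Urysohn functions equal to 1 on
    [A i] and 0 on [B i] are pairwise at distance 1, and [2 u - 1] turns them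
    into functions of norm 1 pairwise at distance 2.  In a linked family at
    most one [A i] and at most one [B i] is empty, and an infinite index type
    can be re-indexed so as to avoid these exceptional indices. *)
Require Import Defs.
From mathcomp Require Import all_boot all_order all_algebra lra.
From mathcomp Require Import all_classical all_reals topology normedtype.
Import Order.TTheory GRing.Theory Num.Theory.
Import numFieldNormedType.Exports.
Local Open Scope classical_set_scope.
Local Open Scope card_scope.
Local Open Scope ring_scope.

(** * Cardinality and injective re-indexing *)

Lemma card_setT_range {I T : Type} {f : I -> T} :
  injective f -> range f #= [set: I].
Proof. by move=> f_inj; apply: inj_card_eq => x y _ _; exact: f_inj. Qed.

Lemma card_setT_enum {I T : Type} {S : set T} :
  S #= [set: I] -> exists2 f : I -> T, injective f & forall i, S (f i).
Proof.
rewrite card_eq_sym => /card_bijP[f /bij_inj f_inj].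
exists (fun i => val (f (SigSub (mem_set (Logic.I : [set: I] i))))) => [i j|i].
  by move=> /val_inj/f_inj/(congr1 val).
exact/set_mem/valP.
Qed.

(** Hilbert's hotel: [phi] shifts an injective sequence that starts at [p]. *)
Lemma infinite_inj_avoid {T : Type} (p : T) :
  infinite_set [set: T] -> exists2 phi : T -> T, injective phi & forall x, phi x <> p.
Proof.
move=> /infinite_setD/(_ (finite_set1 p))/infiniteP.
move=> /card_leP[g].
(* [g] enumerates points different from [p], so putting [p] in front at index 0 keeps the sequence
   injective. *)
pose h n : T := if n is m.+1 then val (g (SigSub (mem_set (Logic.I : [set: nat] m)))) else p.
have hp n : h n.+1 <> p by have /set_mem[] := valP (g (SigSub (mem_set (Logic.I : [set: nat] n)))).
have h_inj : injective h.
  case=> [|m] [|n] // => [/esym/hp//|/hp//|].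
  move=> /val_inj/(inj (mem_set Logic.I) (mem_set Logic.I))/(congr1 val)/= -> //.
(* One step along [h], the identity off its range; the chosen index is the only one because [h] is
   injective. *)
pose phi x := if pselect (exists n, h n = x) is left e then h (projT1 (cid e)).+1 else x.
have phi_h n : phi (h n) = h n.+1.
  rewrite /phi; case: pselect => [e|[]]; last by exists n.
  by congr (h _.+1); apply: h_inj; exact: (projT2 (cid e)).
have phi_id x : ~ (exists n, h n = x) -> phi x = x by rewrite /phi; case: pselect.
exists phi => [x y|x].
  have [[m <-]|hx] := pselect (exists n, h n = x);
    have [[n <-]|hy] := pselect (exists n, h n = y).
  - by rewrite !phi_h => /h_inj[->].
  - by rewrite phi_h phi_id// => hE; case: hy; exists m.+1.
  - by rewrite phi_h phi_id// => hE; case: hx; exists n.+1.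
  - by rewrite !phi_id.
have [[m <-]|hx] := pselect (exists n, h n = x); first by rewrite phi_h.
by rewrite phi_id// => xp; apply: hx; exists 0%N.
Qed.

(** * The supremum norm *)

Section SupNorm.
Context {R : realType} {K : topologicalType}.
Implicit Types (f : K -> R) (r : R).

Lemma sup_norm_le {f r} : 0 <= r -> (forall x, `|f x| <= r) -> sup_norm f <= r.
Proof.
move=> r0 fr; rewrite /sup_norm.
(* For empty [K] the supremum is the default value 0, which [0 <= r] covers. *)
have [->|/set0P N0] := eqVneq [set `|f x| | x in [set: K]] set0.
  by rewrite sup0.
by apply: ge_sup => // _ [x _ <-].
Qed.

Lemma sup_norm_gt {f r} : 0 <= r -> r < sup_norm f -> exists x, r < `|f x|.
Proof.
move=> r0 rf; apply/not_existsP => fr.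
suff : sup_norm f <= r by rewrite leNgt rf.
by apply: sup_norm_le => // x; rewrite leNgt; apply/negP/fr.
Qed.

Lemma sup_norm_max {f} x {r} :
  (forall y, `|f y| <= r) -> `|f x| = r -> sup_norm f = r.
Proof.
move=> fr fx; apply/le_anti/andP; split.
  by apply: sup_norm_le => //; rewrite -fx.
rewrite -fx; apply: ub_le_sup; last by exists x.
by exists r => _ [y _ <-].
Qed.

Lemma le_sup_norm {f} x :
  compact [set: K] -> continuous f -> `|f x| <= sup_norm f.
Proof.
move=> cK cf.
have /compact_bounded[M [_ Mf]] : compact (range f).
  by apply: continuous_compact => //; exact: continuous_subspaceT.
apply: ub_le_sup; last by exists x.
(* Boundedness provides a bound only for each number strictly above [M]. *)
exists (M + 1) => _ [y _ <-]; apply: Mf; first by rewrite ltrDl.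
by exists y.
Qed.

Lemma sup_dist_xx (u : continuousType K R) : sup_dist u u <= 0.
Proof. by apply: sup_norm_le => // x; rewrite /= subrr normr0. Qed.

(** Since a function is at distance at most 0 from itself, [0 < l] forces [u] to be injective, so
    its range is as large as [I]. *)
Lemma equilateral_range {I : Type} {u : I -> continuousType K R} {l : R} :
  0 < l -> (forall i j, i <> j -> sup_dist (u i) (u j) = l) ->
  equilateral sup_dist l (range u) /\ range u #= [set: I].
Proof.
move=> l0 ul; split; last first.
  apply: card_setT_range => i j uij; apply: contrapT => /ul; rewrite uij => E.
  by have := sup_dist_xx (u j); rewrite E leNgt l0.
split=> // _ _ [i _ <-] [j _ <-] uij; apply: ul => ij.
by apply: uij; rewrite ij.
Qed.

End SupNorm.

(** * Linked families of pairs *)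

Section Linked.
Context {I T : Type}.
Implicit Types A B : I -> set T.

Lemma linked_comp {A B} {phi : I -> I} : injective phi ->
  linked A B -> linked (A \o phi) (B \o phi).
Proof.
move=> phi_inj [d n l]; split=> [i|i|i j ij]; [exact: d|exact: n|].
by apply: l => /phi_inj.
Qed.

Lemma linked_sym {A B} : linked A B -> linked B A.
Proof.
move=> [d n l]; split=> [i|i|i j /l[]]; rewrite 1?setIC//; first by rewrite setUC.
- by right.
- by left.
Qed.

(** If [A i] and [A p] are both empty, neither alternative of linkage can hold for [i] and [p];
    hence it suffices to avoid a single index. *)
Lemma linked_left_nonempty {A B} : infinite_set [set: I] -> linked A B ->
  exists2 phi : I -> I, injective phi & forall i, A (phi i) !=set0.
Proof.
move=> Ioo [_ _ l].
have [nA|/existsNP[p /nonemptyPn Ap]] := pselect (forall i, A i !=set0).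
  by exists id.
have [phi phi_inj phip] := infinite_inj_avoid p Ioo.
exists phi => // i; apply/set0P/eqP => Ai.
by have := l _ _ (phip i); rewrite Ai Ap !set0I => -[] [].
Qed.

End Linked.

Lemma linked_closed_nonempty {I : Type} {K : topologicalType} {A B : I -> set K} :
  infinite_set [set: I] -> linked_closed A B ->
  exists A' B' : I -> set K, linked_closed A' B' /\ nonempty_pairs A' B'.
Proof.
move=> Ioo [AB cAB].
have [phi phi_inj Aphi] := linked_left_nonempty Ioo AB.
have AB1 := linked_comp phi_inj AB.
(* The second re-indexing repairs the right-hand sets and keeps the left-hand ones nonempty, as it
   only selects among them. *)
have [psi psi_inj Bpsi] := linked_left_nonempty Ioo (linked_sym AB1).
exists ((A \o phi) \o psi), ((B \o phi) \o psi); split.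
  by split=> [|i]; [exact: linked_comp|exact: cAB].
by move=> i; split; [exact: Aphi|exact: Bpsi].
Qed.

(** The parameters [c] and [r] serve both the ball (values in [[-1, 1]]) and its positive part
    (values in [[0, 1]]). *)
Lemma separated_linked_closed {R : realType} {K : topologicalType} {I : Type}
    (S : set (continuousType K R)) (c r d : R) :
  infinite_set [set: I] -> 0 <= r -> r < d ->
  (forall f x, S f -> `|f x - c| <= r) -> separated_by sup_dist d S ->
  S #= [set: I] -> exists A B : I -> set K, linked_closed A B.
Proof.
move=> Ioo r0 rd Sr Sd /card_setT_enum[u u_inj Su].
(* With this [t], [(d + r) / 2 = r + t]: two values in [[c - r, c + r]] differing by more than that
   lie above [c + t] and below [c - t] respectively. *)
pose t := (d - r) / 2; have t0 : 0 < t by rewrite /t; lra.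
exists (fun i => u i @^-1` [set y | c + t <= y]),
       (fun i => u i @^-1` [set y | y <= c - t]).
have link i j : i <> j ->
    (u i @^-1` [set y | c + t <= y] `&` u j @^-1` [set y | y <= c - t]) !=set0 \/
    (u j @^-1` [set y | c + t <= y] `&` u i @^-1` [set y | y <= c - t]) !=set0.
  move=> ij.
  have [||x] := @sup_norm_gt R K (u i \- u j) ((d + r) / 2); first lra.
    apply: (@lt_le_trans _ _ d); first lra.
    by apply: Sd => // /u_inj.
  have := Sr _ x (Su i); have := Sr _ x (Su j).
  rewrite /= !ler_norml lter_normr => /andP[? ?] /andP[? ?] /orP[?|?].
    by left; exists x; split; rewrite /= /t; lra.
  by right; exists x; split; rewrite /= /t; lra.
split; last first.
  move=> i; split; apply: closed_comp; try by move=> x _; exact: cts_fun.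
    exact: closed_ge.
  exact: closed_le.
split=> // i.
  by rewrite -subset0 => x [/=]; lra.
(* Linking [i] with some other index, [phi i], yields a point of one of the two sets at [i]. *)
have [phi _ phii] := infinite_inj_avoid i Ioo.
by have [[x []]|[x []]] := link _ _ (phii i) => ? ?; exists x; [right|left].
Qed.

(** * Equilateral sets from Urysohn functions *)

Lemma linked_urysohn (R : realType) {K : topologicalType} {I : Type}
    {A B : I -> set K} :
  compact [set: K] -> hausdorff_space K -> linked_closed A B ->
  exists u : I -> continuousType K R,
    [/\ forall i x, 0 <= u i x <= 1, forall i x, A i x -> u i x = 1 &
        forall i x, B i x -> u i x = 0].
Proof.
move=> cK hK [[dAB _ _] cAB].
have nK := compact_normal hK cK.
suff /choice[u uP] : forall i, exists u : continuousType K R,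
    [/\ forall x, 0 <= u x <= 1, forall x, A i x -> u x = 1 &
        forall x, B i x -> u x = 0].
  by exists u; split=> i; have [] := uP i.
move=> i; have [cA cB] := cAB i.
have := @normal_separatorP R K; move=> -[/(_ nK) sep _].
have /(@uniform_separatorP _ R)[f [cf f01 f0 f1]] :
  uniform_separator (B i) (A i) by apply: sep; rewrite // setIC.
exists (mkcts cf); split=> x.
- by have := f01 (f x); rewrite /= in_itv/=; apply; exists x.
- by move=> Ax; apply: f1; exists x.
- by move=> Bx; apply: f0; exists x.
Qed.

Section FromLinked.
Context {R : realType} {K : topologicalType} {I : Type}.
Context {A B : I -> set K}.
Hypotheses (cK : compact [set: K]) (hK : hausdorff_space K).
Hypotheses (AB : linked_closed A B) (nAB : nonempty_pairs A B).

Lemma linked_pos_sphere : exists S : set (continuousType K R),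
  [/\ S `<=` CK_pos_unit_sphere, equilateral sup_dist 1 S & S #= [set: I]].
Proof.
have [u [u01 uA uB]] := linked_urysohn R cK hK AB.
have [|S1 SI] := @equilateral_range R K I u 1 ltr01; last first.
  exists (range u); split=> // _ [i _ <-]; split; last first.
    by move=> x; have /andP[] := u01 i x.
  (* A point of the nonempty set [A i] is where the norm 1 is attained. *)
  have [[x Ax] _] := nAB i; apply: (sup_norm_max x) => [y|].
    by have /andP[? ?] := u01 i y; rewrite ger0_norm.
  by rewrite uA// normr1.
move=> i j ij; have [[_ _ /(_ _ _ ij) l] _] := AB.
(* At a linking point one function is 1 and the other 0, the largest gap possible in [[0, 1]]. *)
have [x E] : exists x, `|u i x - u j x| = 1.
  case: l => -[x [Ax Bx]]; exists x; rewrite (uA _ _ Ax) (uB _ _ Bx).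
    by rewrite subr0 normr1.
  by rewrite sub0r normrN1.
apply: (sup_norm_max x) => // y.
by have := u01 i y; have := u01 j y; rewrite /= ler_norml; lra.
Qed.

Lemma linked_sphere : exists S : set (continuousType K R),
  [/\ S `<=` CK_unit_sphere, equilateral sup_dist 2 S & S #= [set: I]].
Proof.
have [u [u01 uA uB]] := linked_urysohn R cK hK AB.
have cv i : continuous (fun x => 2 * u i x - 1 : R).
  move=> x; apply: cvgB; last exact: cvg_cst.
  by apply: cvgM; [exact: cvg_cst|exact: cts_fun].
pose v i : continuousType K R := mkcts (cv i).
have [|S2 SI] := @equilateral_range R K I v 2 ltac:(lra); last first.
  exists (range v); split=> // _ [i _ <-].
  have [[x Ax] _] := nAB i; apply: (sup_norm_max x) => [y|].
    by have := u01 i y; rewrite /= /mkcts ler_norml; lra.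
  by rewrite /= /mkcts uA// ger0_norm; lra.
move=> i j ij; have [[_ _ /(_ _ _ ij) l] _] := AB.
have [x E] : exists x, `|v i x - v j x| = 2.
  case: l => -[x [Ax Bx]]; exists x; rewrite /= /mkcts (uA _ _ Ax) (uB _ _ Bx).
    by rewrite ger0_norm; lra.
  by rewrite ler0_norm; lra.
apply: (sup_norm_max x) => // y.
by have := u01 i y; have := u01 j y; rewrite /= /mkcts ler_norml; lra.
Qed.

End FromLinked.

Lemma equilateral_separated {R : realType} {M : Type} {d : M -> M -> R} {l S} :
  equilateral d l S -> separated_by d l S.
Proof. by move=> [_ Sl] x y Sx Sy xy; rewrite Sl. Qed.

Lemma CK_unit_sphere_ball {R : realType} {K : topologicalType} :
  (@CK_unit_sphere R K) `<=` CK_unit_ball.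
Proof. by move=> f; rewrite /CK_unit_sphere /CK_unit_ball /= => ->. Qed.

Theorem theorem1 (R : realType) (K : topologicalType)
    (K_compact : compact [set: K]) (K_hausdorff : hausdorff_space K)
    (alpha : Type) (alpha_infinite : infinite_set [set: alpha]) :
  [<-> exists lambda : R, 1 < lambda /\
         exists S : set (continuousType K R),
           [/\ S `<=` CK_unit_ball, equilateral sup_dist lambda S &
               S #= [set: alpha]];
       exists S : set (continuousType K R),
         [/\ S `<=` CK_unit_sphere, equilateral sup_dist 2 S &
             S #= [set: alpha]];
       exists S : set (continuousType K R),
         [/\ S `<=` CK_pos_unit_sphere, equilateral sup_dist 1 S &
             S #= [set: alpha]];
       exists eps : R, 0 < eps /\
         exists D : set (continuousType K R),
           [/\ D `<=` CK_unit_ball, separated_by sup_dist (1 + eps) D &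
               D #= [set: alpha]];
       exists A B : alpha -> set K, linked_closed A B;
       exists A B : alpha -> set K, linked_closed A B /\ nonempty_pairs A B].
Proof.
have ball_linked (d : R) (S : set (continuousType K R)) :
    1 < d -> S `<=` CK_unit_ball -> separated_by sup_dist d S ->
    S #= [set: alpha] -> exists A B : alpha -> set K, linked_closed A B.
  move=> d1 Sball Sd; apply: (separated_linked_closed S 0 1 d) => //.
  move=> f x /Sball; rewrite subr0; apply: le_trans.
  by apply: le_sup_norm => //; exact: cts_fun.
have pos_linked (S : set (continuousType K R)) :
    S `<=` CK_pos_unit_sphere -> separated_by sup_dist 1 S ->
    S #= [set: alpha] -> exists A B : alpha -> set K, linked_closed A B.
  (* Centring at 1/2 gives radius 1/2, so that separation 1 is strictly larger than the radius. *)
  move=> Ssph Sd; apply: (separated_linked_closed S (1/2) (1/2) 1) => //; try lra.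
  move=> f x /Ssph[f1 f0].
  have := le_sup_norm x K_compact (@cts_fun _ _ f); rewrite f1.
  by rewrite !ler_norml; have := f0 x; lra.
have sphere : (exists A B : alpha -> set K, linked_closed A B) ->
    exists S : set (continuousType K R),
      [/\ S `<=` CK_unit_sphere, equilateral sup_dist 2 S & S #= [set: alpha]].
  move=> [A [B /(linked_closed_nonempty alpha_infinite)[A' [B' [AB nAB]]]]].
  exact: linked_sphere K_compact K_hausdorff AB nAB.
(* The cycle of implications passes through linked families; the sets it produces in the ball are
   2-equilateral, whence [eps = 1] and [lambda = 2]. *)
tfae.
- move=> [l [l1 [S [Sball /equilateral_separated Sl Salpha]]]].
  exact/sphere/(ball_linked l S).
- move=> [S [Ssph /equilateral_separated S2 Salpha]].
  have [||A [B /(linked_closed_nonempty alpha_infinite)[A' [B' [AB nAB]]]]] :=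
    ball_linked 2 S _ _ S2 Salpha.
  + lra.
  + exact: subset_trans Ssph CK_unit_sphere_ball.
  exact: linked_pos_sphere K_compact K_hausdorff AB nAB.
- move=> [S [Ssph /equilateral_separated S1 Salpha]].
  have [S' [S'sph /equilateral_separated S'2 S'alpha]] :=
    sphere (pos_linked S Ssph S1 Salpha).
  exists 1; split=> //; exists S'; split=> //.
  exact: subset_trans S'sph CK_unit_sphere_ball.
- move=> [e [e0 [D [Dball De Dalpha]]]].
  by apply: (ball_linked (1 + e) D) => //; lra.
- by move=> [A [B /(linked_closed_nonempty alpha_infinite)]].
- move=> [A [B [AB _]]].
  have [|S [Ssph S2 Salpha]] := sphere; first by exists A, B.
  exists 2; split; first lra.
  by exists S; split=> //; exact: subset_trans Ssph CK_unit_sphere_ball.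
Qed.
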